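(* Let $L(x)=-\log|x|$ and let $u$ be the function near $x=0$ in $\mathbb{R}$ with $u(0)=0$ and $u'(x)=L(x)^{1/2}$ for $x\neq0$. Then, in a neighborhood of $x=0$, $u$ is a viscosity solution, not Lipschitz at $0$, of an equation of the form $$\arctan(u'')=-\arctan\left[\tfrac12\,x\,g(u')\right],$$ where $g(p)=e^{2p^2}/p$ for $|p|$ near $\infty$. The phase $\Theta(x,p)=-\arctan[\frac12 x g(p)]$ fails both of the following conditions (for every constant $C$, with $x$ near $0$ and $p$ in the range of $u'$ near $0$): $|p|\,|D_p\Theta|\le C\left(\Theta+\frac{\pi}{2}\right)$, and the condition that $|\Theta_{xx}|$ be uniformly bounded together with $|D_x\Theta|\le C\left(\Theta+\frac{\pi}{2}\right)^{1/2}$.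
   Context: A continuous function $u$ is a viscosity solution of $\arctan(u'')=\Theta(x,u,u')$ on an open interval if, for every $x_0$ and every $C^2$ function $\varphi$ near $x_0$ with $\varphi(x_0)=u(x_0)$: if $\varphi\ge u$ near $x_0$ then $\arctan\varphi''(x_0)\ge\Theta(x_0,u(x_0),\varphi'(x_0))$, and if $\varphi\le u$ near $x_0$ then $\arctan\varphi''(x_0)\le\Theta(x_0,u(x_0),\varphi'(x_0))$. For bounded $p$, $g$ may be any smooth function extending the given formula. *)

(* Defs.v *)
From Stdlib Require Import Reals.
From Coquelicot Require Import Coquelicot.
Open Scope R_scope.

(* [Derive phi] is a total function, so differentiability of [phi] itself must
   be required in addition to that of [Derive phi]. *)
Definition C2_near (phi : R -> R) (x0 : R) : Prop :=
  locally x0 (fun x => ex_derive phi x /\ ex_derive (Derive phi) x /\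
                       continuous (Derive_n phi 2) x).

(* Viscosity solutions of arctan(u'') = Theta(x, u, u') on the interval (a, b). *)
Definition viscosity_solution (Theta : R -> R -> R -> R) (a b : R) (u : R -> R) : Prop :=
  (forall x, a < x < b -> continuous u x) /\
  (forall x0, a < x0 < b ->
   forall phi : R -> R, C2_near phi x0 -> phi x0 = u x0 ->
     (locally x0 (fun x => phi x >= u x) ->
        atan (Derive_n phi 2 x0) >= Theta x0 (u x0) (Derive phi x0)) /\
     (locally x0 (fun x => phi x <= u x) ->
        atan (Derive_n phi 2 x0) <= Theta x0 (u x0) (Derive phi x0))).

Definition lipschitz_at (u : R -> R) (x0 : R) : Prop :=
  exists K : R, locally x0 (fun x => Rabs (u x - u x0) <= K * Rabs (x - x0)).

Definition smooth (g : R -> R) : Prop := forall (n : nat) (p : R), ex_derive_n g n p.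

Definition L (x : R) : R := - ln (Rabs x).

(* Continuity at 0 is what makes the germ of [u] at 0 unique: otherwise the
   one-sided antiderivatives could be shifted by independent constants. *)
Definition log_profile (u : R -> R) : Prop :=
  u 0 = 0 /\ continuous u 0 /\ locally' 0 (fun x => is_derive u x (sqrt (L x))).

Definition admissible (g : R -> R) : Prop :=
  smooth g /\ exists M : R, forall p, M < Rabs p -> g p = exp (2 * p ^ 2) / p.

Definition phase (g : R -> R) (x p : R) : R := - atan (1 / 2 * x * g p).

(* Pairs (x, p) with x within eta of 0 and p a value of u' within eta of 0;
   the point 0 is excluded because u'(0) does not exist. *)
Definition near_range (u : R -> R) (eta x p : R) : Prop :=
  Rabs x < eta /\ exists y, 0 < Rabs y < eta /\ p = Derive u y.

Definition p_condition (Theta : R -> R -> R) (D : R -> R -> Prop) : Prop :=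
  exists C : R, forall x p, D x p ->
    Rabs p * Rabs (Derive (fun q => Theta x q) p) <= C * (Theta x p + PI / 2).

Definition x_condition (Theta : R -> R -> R) (D : R -> R -> Prop) : Prop :=
  (exists K : R, forall x p, D x p ->
     Rabs (Derive_n (fun y => Theta y p) 2 x) <= K) /\
  (exists C : R, forall x p, D x p ->
     Rabs (Derive (fun y => Theta y p) x) <= C * sqrt (Theta x p + PI / 2)).

(* Main.v *)
Require Import Defs.
From Stdlib Require Import Reals Factorial Lra Lia.
From Coquelicot Require Import Coquelicot.
Open Scope R_scope.

(** Write [p = u'(x) = sqrt (L x)], so that [exp (p^2) = 1 / |x|]. Away from [0],
    [u'' = - 1 / (2 x p) = - 1/2 x g(p)], hence [u] is a classical solution there,
    and the second derivative test makes it a viscosity solution. At [0] the graph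
    of [u] has a vertical tangent, so no differentiable function touches it from
    either side and the viscosity conditions hold vacuously. Both structure
    conditions break along the curve [1/2 x g(p) = 1], where [Theta = - PI / 4]
    stays away from [- PI / 2] while [|p| |D_p Theta| = (4 p^2 - 1) / 2] and
    [|D_x Theta| = g(p) / 4] are unbounded. *)

(** * Neighbourhoods on the line and the product rule *)

Lemma locally_Rabs_intro (x e : R) (P : R -> Prop) :
  0 < e -> (forall y, Rabs (y - x) < e -> P y) -> locally x P.
Proof. intros He H. exists (mkposreal e He). exact H. Qed.

Lemma locally_Rabs_elim (x : R) (P : R -> Prop) :
  locally x P -> exists e, 0 < e /\ forall y, Rabs (y - x) < e -> P y.
Proof. intros [e He]. exists e. split; [apply cond_pos | exact He]. Qed.

Lemma is_derive_Rmult (f g : R -> R) (x df dg : R) :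
  is_derive f x df -> is_derive g x dg ->
  is_derive (fun y => f y * g y) x (df * g x + f x * dg).
Proof.
  intros Hf Hg.
  apply (is_derive_mult f g x df dg Hf Hg). intros n m; apply Rmult_comm.
Qed.

(** * Closure properties of smooth functions *)

(** Carrying an explicit derivative as a function makes closure under products, inverses and
    composition a short induction, with no formula for higher derivatives. *)
Fixpoint differentiable_upto (n : nat) (f : R -> R) : Prop :=
  match n with
  | O => True
  | S m => exists f', (forall x, is_derive f x (f' x)) /\ differentiable_upto m f'
  end.

Lemma differentiable_upto_S (n : nat) (f : R -> R) :
  differentiable_upto (S n) f -> differentiable_upto n f.
Proof.
  revert f; induction n as [|n IH]; intros f H; [exact I|].
  destruct H as [f' [Hf Hf']]. exists f'. split; [exact Hf | now apply IH].
Qed.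

Lemma differentiable_upto_ext (n : nat) (f g : R -> R) :
  (forall x, f x = g x) -> differentiable_upto n f -> differentiable_upto n g.
Proof.
  destruct n as [|n]; intros Hfg H; [exact I|].
  destruct H as [f' [Hf Hf']]. exists f'. split; [|exact Hf'].
  intros x. now apply (is_derive_ext f).
Qed.

Lemma differentiable_upto_const (n : nat) (c : R) :
  differentiable_upto n (fun _ => c).
Proof.
  revert c; induction n as [|n IH]; intros c; [exact I|].
  exists (fun _ => 0). split; [|apply IH].
  intros x. apply @is_derive_const.
Qed.

Lemma differentiable_upto_id (n : nat) : differentiable_upto n (fun x => x).
Proof.
  destruct n as [|n]; [exact I|].
  exists (fun _ => 1). split; [|apply differentiable_upto_const].
  intros x. apply @is_derive_id.
Qed.

Lemma differentiable_upto_plus (n : nat) (f g : R -> R) :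
  differentiable_upto n f -> differentiable_upto n g ->
  differentiable_upto n (fun x => f x + g x).
Proof.
  revert f g; induction n as [|n IH]; intros f g Hf Hg; [exact I|].
  destruct Hf as [f' [Hf Hf']]; destruct Hg as [g' [Hg Hg']].
  exists (fun x => f' x + g' x). split; [|now apply IH].
  intros x. apply (is_derive_plus f g x _ _ (Hf x) (Hg x)).
Qed.

Lemma differentiable_upto_mult (n : nat) (f g : R -> R) :
  differentiable_upto n f -> differentiable_upto n g ->
  differentiable_upto n (fun x => f x * g x).
Proof.
  revert f g; induction n as [|n IH]; intros f g Hf Hg; [exact I|].
  (* The derivative of a product contains the undifferentiated factors, so these are needed at order
     [n] as well. *)
  pose proof (differentiable_upto_S _ _ Hf) as Hf0.
  pose proof (differentiable_upto_S _ _ Hg) as Hg0.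
  destruct Hf as [f' [Hf Hf']]; destruct Hg as [g' [Hg Hg']].
  exists (fun x => f' x * g x + f x * g' x). split.
  - intros x. now apply is_derive_Rmult.
  - apply differentiable_upto_plus; now apply IH.
Qed.

Lemma differentiable_upto_inv (n : nat) (f : R -> R) :
  (forall x, f x <> 0) -> differentiable_upto n f ->
  differentiable_upto n (fun x => / f x).
Proof.
  intros Hnz; revert f Hnz; induction n as [|n IH]; intros f Hnz Hf; [exact I|].
  pose proof (differentiable_upto_S _ _ Hf) as Hf0.
  destruct Hf as [f' [Hf Hf']].
  (* Written as a product of [f'] and copies of [/ f], to which the induction hypothesis applies at
     order [n]. *)
  exists (fun x => (-1 * f' x) * (/ f x * / f x)). split.
  - intros x. replace (-1 * f' x * (/ f x * / f x)) with (- f' x / f x ^ 2).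
    + apply is_derive_inv; auto.
    + field. apply Hnz.
  - apply differentiable_upto_mult.
    + apply differentiable_upto_mult; [apply differentiable_upto_const | exact Hf'].
    + apply differentiable_upto_mult; now apply IH.
Qed.

Lemma differentiable_upto_comp (n : nat) (f g : R -> R) :
  differentiable_upto n f -> differentiable_upto n g ->
  differentiable_upto n (fun x => f (g x)).
Proof.
  revert f g; induction n as [|n IH]; intros f g Hf Hg; [exact I|].
  pose proof (differentiable_upto_S _ _ Hg) as Hg0.
  destruct Hf as [f' [Hf Hf']]; destruct Hg as [g' [Hg Hg']].
  exists (fun x => g' x * f' (g x)). split.
  - intros x. apply (is_derive_comp f g x _ _ (Hf (g x)) (Hg x)).
  - apply differentiable_upto_mult; [exact Hg' | now apply IH].
Qed.

Lemma differentiable_upto_exp (n : nat) : differentiable_upto n exp.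
Proof.
  induction n as [|n IH]; [exact I|].
  exists exp. split; [exact is_derive_exp | exact IH].
Qed.

(** The recursion peels off the innermost derivative while [Derive_n] adds the outermost one;
    [Derive_n_comp] reconciles the two orders. *)
Lemma differentiable_upto_Derive_n (n : nat) (f : R -> R) :
  differentiable_upto (S n) f -> forall x, ex_derive (Derive_n f n) x.
Proof.
  revert f; induction n as [|n IH]; intros f [f' [Hf Hf']] x.
  - exists (f' x). apply Hf.
  - apply (ex_derive_ext (Derive_n f' n)); [|now apply IH].
    intros t. replace (S n) with (n + 1)%nat by lia.
    rewrite <- Derive_n_comp. apply Derive_n_ext.
    intros s. symmetry. apply is_derive_unique, Hf.
Qed.

Lemma smooth_of_differentiable_upto (f : R -> R) :
  (forall n, differentiable_upto n f) -> smooth f.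
Proof.
  intros H [|n] p; [exact I|].
  now apply differentiable_upto_Derive_n.
Qed.

(** * A flat function and a smooth extension of the formula for [g] *)

(** For [k = 0] this is the classical smooth function flat at the origin. The powers of [/ x] are
    included so that the span of the family is stable under differentiation. *)
Definition flat (k : nat) (x : R) : R :=
  if Rlt_dec 0 x then (/ x) ^ k * exp (- / x) else 0.

(** With [t = / x], one term of the exponential series gives [exp t >= t ^ (k + 2) / (k + 2)!]. The
    quadratic bound then forces a zero derivative at the origin. *)
Lemma flat_bound (k : nat) (x : R) :
  0 <= flat k x <= INR (fact (k + 2)) * x ^ 2.
Proof.
  unfold flat.
  assert (Hfact : 0 < INR (fact (k + 2))) by apply INR_fact_lt_0.
  destruct (Rlt_dec 0 x) as [Hx|Hx].
  2: { split; [lra|]. apply Rmult_le_pos; [lra | apply pow2_ge_0]. }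
  assert (Ht : 0 < / x) by now apply Rinv_0_lt_compat.
  assert (Hk : 0 < (/ x) ^ k) by now apply pow_lt.
  pose proof (exp_pos (- / x)) as He.
  split; [apply Rmult_le_pos; lra|].
  pose proof (exp_ge_taylor (/ x) (k + 2) (Rlt_le _ _ Ht)) as HT.
  assert (Hlast : (/ x) ^ (k + 2) / INR (fact (k + 2)) <= exp (/ x)).
  { apply Rle_trans with (2 := HT).
    replace (k + 2)%nat with (S (k + 1)) by lia.
    rewrite tech5.
    assert (0 <= sum_f_R0 (fun k0 => (/ x) ^ k0 / INR (fact k0)) (k + 1)).
    { apply cond_pos_sum. intros m.
      apply Rmult_le_pos; [apply pow_le; lra|].
      apply Rlt_le, Rinv_0_lt_compat, INR_fact_lt_0. }
    lra. }
  rewrite pow_add in Hlast.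
  rewrite exp_Ropp.
  pose proof (exp_pos (/ x)) as He'.
  apply Rmult_le_reg_r with (exp (/ x)); [exact He'|].
  rewrite Rmult_assoc, Rinv_l, Rmult_1_r by lra.
  apply Rle_trans with (INR (fact (k + 2)) * x ^ 2 *
     ((/ x) ^ k * (/ x) ^ 2 / INR (fact (k + 2)))).
  - right. field. split; lra.
  - apply Rmult_le_compat_l; [|exact Hlast].
    apply Rmult_le_pos; [lra | apply pow2_ge_0].
Qed.

Lemma flat_derive (k : nat) (x : R) :
  is_derive (flat k) x (flat (k + 2) x + - INR k * flat (k + 1) x).
Proof.
  destruct (Rtotal_order x 0) as [Hx|[Hx|Hx]].
  - apply (is_derive_ext_loc (fun _ => 0)).
    + apply locally_Rabs_intro with (- x); [lra|].
      intros y Hy. apply Rabs_def2 in Hy.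
      unfold flat. destruct (Rlt_dec 0 y); lra.
    + unfold flat. destruct (Rlt_dec 0 x); [lra|].
      replace (0 + - INR k * 0) with 0 by ring.
      apply @is_derive_const.
  - subst x.
    replace (flat (k + 2) 0 + - INR k * flat (k + 1) 0) with 0
      by (unfold flat; destruct (Rlt_dec 0 0); lra).
    apply is_derive_Reals. intros eps Heps.
    assert (Hc : 0 < INR (fact (k + 2))) by apply INR_fact_lt_0.
    assert (Hd : 0 < eps / INR (fact (k + 2))) by now apply Rdiv_lt_0_compat.
    exists (mkposreal _ Hd). simpl. intros h Hh Hhd.
    assert (H0 : flat k 0 = 0) by (unfold flat; destruct (Rlt_dec 0 0); lra).
    rewrite H0, Rplus_0_l, !Rminus_0_r.
    pose proof (flat_bound k h) as [Hb1 Hb2].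
    rewrite Rabs_div by exact Hh.
    rewrite (Rabs_pos_eq (flat k h)) by exact Hb1.
    assert (Hah : 0 < Rabs h) by now apply Rabs_pos_lt.
    apply Rmult_lt_reg_r with (Rabs h); [exact Hah|].
    unfold Rdiv. rewrite Rmult_assoc, Rinv_l, Rmult_1_r by lra.
    rewrite <- pow2_abs in Hb2.
    apply Rle_lt_trans with (1 := Hb2).
    assert (INR (fact (k + 2)) * Rabs h < eps).
    { apply Rmult_lt_reg_r with (/ INR (fact (k + 2))).
      - now apply Rinv_0_lt_compat.
      - replace (INR (fact (k + 2)) * Rabs h * / INR (fact (k + 2)))
          with (Rabs h) by (field; lra). exact Hhd. }
    simpl. rewrite Rmult_1_r, <- Rmult_assoc. now apply Rmult_lt_compat_r.
  - apply (is_derive_ext_loc (fun y => (/ y) ^ k * exp (- / y))).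
    + apply locally_Rabs_intro with x; [lra|].
      intros y Hy. apply Rabs_def2 in Hy.
      unfold flat. destruct (Rlt_dec 0 y); lra.
    + unfold flat. destruct (Rlt_dec 0 x); [|lra].
      auto_derive; [lra|].
      (* The power rule produces the exponent [pred k], which for [k = 0] is not [k - 1] but comes
         with the coefficient [0]. *)
      destruct k as [|k].
      * simpl. field. lra.
      * rewrite !pow_add. change (Init.Nat.pred (S k)) with k.
        change ((/ x) ^ S k) with (/ x * (/ x) ^ k). field. lra.
Qed.

Lemma flat_differentiable_upto (n k : nat) : differentiable_upto n (flat k).
Proof.
  revert k; induction n as [|n IH]; intros k; [exact I|].
  exists (fun x => flat (k + 2) x + - INR k * flat (k + 1) x).
  split; [apply flat_derive|].
  apply differentiable_upto_plus; [apply IH|].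
  apply differentiable_upto_mult; [apply differentiable_upto_const | apply IH].
Qed.

(* The flat term removes the pole of [1 / p] at [0] and vanishes for [|p| >= 1]. *)
Lemma admissible_exists : exists g : R -> R, admissible g.
Proof.
  (* Only sums, products and constants appear, so that the closure lemmas apply directly. *)
  set (den := fun p : R => p * p + flat 0 (1 + -1 * (p * p))).
  assert (Hden : forall p, den p <> 0).
  { intros p. unfold den.
    pose proof (flat_bound 0 (1 + -1 * (p * p))) as [Hb _].
    destruct (Req_dec p 0) as [->|Hp].
    - unfold flat. destruct (Rlt_dec 0 (1 + -1 * (0 * 0))); [|lra].
      pose proof (exp_pos (- / (1 + -1 * (0 * 0)))). simpl. lra.
    - assert (0 < p * p) by nra. lra. }
  exists (fun p => exp (2 * (p * p)) * (p * / den p)). split.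
  - apply smooth_of_differentiable_upto. intros n.
    assert (Hid := differentiable_upto_id n).
    assert (Hsq : differentiable_upto n (fun p => p * p))
      by now apply differentiable_upto_mult.
    apply differentiable_upto_mult.
    + apply (differentiable_upto_comp n exp); [apply differentiable_upto_exp|].
      apply differentiable_upto_mult; [apply differentiable_upto_const | exact Hsq].
    + apply differentiable_upto_mult; [exact Hid|].
      apply differentiable_upto_inv; [exact Hden|].
      apply differentiable_upto_plus; [exact Hsq|].
      apply (differentiable_upto_comp n (flat 0)); [apply flat_differentiable_upto|].
      apply differentiable_upto_plus; [apply differentiable_upto_const|].
      apply differentiable_upto_mult; [apply differentiable_upto_const | exact Hsq].
  - exists 1. intros p Hp.
    assert (Hpp : 1 < p * p).
    { rewrite <- (Rabs_pos_eq (p * p)) by nra. rewrite Rabs_mult. nra. }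
    assert (Hp0 : p <> 0) by (intros ->; lra).
    unfold den, flat. destruct (Rlt_dec 0 (1 + -1 * (p * p))); [lra|].
    replace (p ^ 2) with (p * p) by ring. field. exact Hp0.
Qed.

(** * Size and derivatives of [L] and of its square root *)

Lemma L_gt (K x : R) : x <> 0 -> Rabs x < exp (- K) -> K < L x.
Proof.
  intros Hx HK. unfold L.
  apply ln_increasing in HK; [|now apply Rabs_pos_lt].
  rewrite ln_exp in HK. lra.
Qed.

Lemma sqrt_L_gt (K x : R) :
  x <> 0 -> Rabs x < exp (- (K ^ 2)) -> K < sqrt (L x).
Proof.
  intros Hx HK. apply L_gt in HK; [|exact Hx].
  pose proof (sqrt_pos (L x)).
  destruct (Rlt_dec K 0) as [Hn|Hn]; [lra|].
  apply Rsqr_incrst_0; [|lra|lra].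
  rewrite Rsqr_sqrt; unfold Rsqr; nra.
Qed.

Lemma L_pos (x : R) : x <> 0 -> Rabs x < 1 -> 0 < L x.
Proof. intros Hx H1. apply L_gt; [exact Hx|]. now rewrite Ropp_0, exp_0. Qed.

Lemma is_derive_L (x : R) : x <> 0 -> is_derive L x (- / x).
Proof.
  intros Hx. unfold L.
  assert (H0 : 0 < Rabs x) by now apply Rabs_pos_lt.
  auto_derive; [now split|].
  replace (1 * sign x * / Rabs x) with (/ x); [reflexivity|].
  destruct (Rdichotomy _ _ Hx) as [Hl|Hr].
  - rewrite sign_eq_m1, Rabs_left by lra. field. lra.
  - rewrite sign_eq_1, Rabs_pos_eq by lra. field. lra.
Qed.

Lemma is_derive_sqrt_L (x : R) :
  x <> 0 -> Rabs x < 1 ->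
  is_derive (fun y => sqrt (L y)) x (- / (2 * x * sqrt (L x))).
Proof.
  intros Hx H1. pose proof (L_pos x Hx H1) as HL.
  pose proof (sqrt_lt_R0 _ HL) as Hs.
  replace (- / (2 * x * sqrt (L x))) with (- / x / (2 * sqrt (L x)))
    by (field; lra).
  apply is_derive_sqrt; [now apply is_derive_L | exact HL].
Qed.

Lemma locally_punctured (x d : R) (P : R -> Prop) :
  x <> 0 -> Rabs x < d -> (forall y, y <> 0 -> Rabs y < d -> P y) -> locally x P.
Proof.
  intros Hx Hd H.
  assert (H0 : 0 < Rabs x) by now apply Rabs_pos_lt.
  (* The distances from [x] to [0] and to the ends of the interval. *)
  apply locally_Rabs_intro with (Rmin (Rabs x) (d - Rabs x)).
  - apply Rmin_pos; lra.
  - intros y Hy.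
    pose proof (Rmin_l (Rabs x) (d - Rabs x)).
    pose proof (Rmin_r (Rabs x) (d - Rabs x)).
    apply H.
    + intros ->. rewrite Rminus_0_l, Rabs_Ropp in Hy. lra.
    + pose proof (Rabs_triang (y - x) x) as HT.
      replace (y - x + x) with y in HT by ring. lra.
Qed.

(** * Existence of the profile [u] *)

(** From [1 + ln t <= t] at [t = / Rabs x] follows [L x <= / Rabs x], hence
    [x ^ 2 * L x <= Rabs x]. *)
Lemma x_sqrt_L_bound (x : R) : Rabs (x * sqrt (L x)) <= sqrt (Rabs x).
Proof.
  destruct (Req_dec x 0) as [->|Hx].
  { rewrite Rmult_0_l, Rabs_R0, sqrt_0. lra. }
  assert (H0 : 0 < Rabs x) by now apply Rabs_pos_lt.
  rewrite Rabs_mult, (Rabs_pos_eq (sqrt _)) by apply sqrt_pos.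
  rewrite <- (sqrt_square (Rabs x)) at 1 by lra.
  rewrite <- sqrt_mult_alt by nra.
  apply sqrt_le_1_alt.
  assert (HL : L x <= / Rabs x).
  { unfold L. rewrite <- ln_Rinv by exact H0.
    pose proof (exp_ineq1_le (ln (/ Rabs x))) as He.
    rewrite exp_ln in He by now apply Rinv_0_lt_compat. lra. }
  apply Rle_trans with (Rabs x * Rabs x * / Rabs x).
  - apply Rmult_le_compat_l; [nra | exact HL].
  - right. field. lra.
Qed.

Lemma continuous_x_sqrt_L : continuous (fun x => x * sqrt (L x)) 0.
Proof.
  apply continuity_pt_filterlim.
  intros eps Heps. exists (eps * eps). split; [apply Rmult_gt_0_compat; lra|].
  intros x [_ Hx]. unfold dist in *; simpl in *; unfold Rdist in *.
  rewrite Rmult_0_l, Rminus_0_r in *.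
  apply Rle_lt_trans with (1 := x_sqrt_L_bound x).
  rewrite <- (sqrt_square eps) by lra.
  apply sqrt_lt_1_alt. split; [apply Rabs_pos | exact Hx].
Qed.

Lemma continuous_inv_sqrt_L (x : R) :
  Rabs x < 1 -> continuous (fun y => / (2 * sqrt (L y))) x.
Proof.
  intros H1. destruct (Req_dec x 0) as [->|Hx].
  - apply continuity_pt_filterlim.
    (* Within this radius [sqrt (L x)] exceeds [/ eps]. *)
    intros eps Heps. exists (exp (- ((/ eps) ^ 2))). split; [apply exp_pos|].
    intros x [[_ Hx0] Hx]. unfold dist in *; simpl in *; unfold Rdist in *.
    rewrite Rminus_0_r in Hx.
    (* [ln 0 = 0], [sqrt 0 = 0] and [/ 0 = 0] make the value at [0] the limit *)
    assert (HL0 : / (2 * sqrt (L 0)) = 0).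
    { unfold L. rewrite Rabs_R0.
      replace (ln 0) with 0
        by (unfold ln; destruct (Rlt_dec 0 0) as [H0|H0]; [exfalso; exact (Rlt_irrefl 0 H0) | reflexivity]).
      now rewrite Ropp_0, sqrt_0, Rmult_0_r, Rinv_0. }
    rewrite HL0, Rminus_0_r.
    apply sqrt_L_gt in Hx; [|intro; now apply Hx0].
    assert (Hie : 0 < / eps) by now apply Rinv_0_lt_compat.
    rewrite Rabs_pos_eq
      by (apply Rlt_le, Rinv_0_lt_compat; lra).
    rewrite <- (Rinv_inv eps). apply Rinv_lt_contravar; [nra | lra].
  - pose proof (L_pos x Hx H1) as HL.
    pose proof (sqrt_lt_R0 _ HL) as Hs.
    apply (ex_derive_continuous (fun y => / (2 * sqrt (L y))) x).
    eexists. apply is_derive_inv; [|lra].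
    apply is_derive_scal. now apply is_derive_sqrt_L.
Qed.

(* Integration by parts:
   [(x sqrt (L x))' = sqrt (L x) - 1 / (2 sqrt (L x))], and the last term is
   continuous at [0]. *)
Lemma log_profile_exists : exists u : R -> R, log_profile u.
Proof.
  set (q := fun y => / (2 * sqrt (L y))).
  assert (HI : forall x, Rabs x < 1 -> is_derive (RInt q 0) x (q x)).
  { intros x Hx. apply (is_derive_RInt q (RInt q 0) 0 x).
    - apply locally_Rabs_intro with (1 - Rabs x); [lra|].
      intros y Hy. apply (RInt_correct q), (ex_RInt_continuous q).
      intros z Hz. apply continuous_inv_sqrt_L.
      assert (Hy1 : Rabs y < 1).
      { pose proof (Rabs_triang (y - x) x) as HT.
        replace (y - x + x) with y in HT by ring. lra. }
      apply Rabs_def2 in Hy1. apply Rabs_def1.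
      + apply Rle_lt_trans with (Rmax 0 y); [tauto|]. apply Rmax_lub_lt; lra.
      + apply Rlt_le_trans with (Rmin 0 y); [|tauto]. apply Rmin_glb_lt; lra.
    - now apply continuous_inv_sqrt_L. }
  exists (fun x => x * sqrt (L x) + RInt q 0 x). split; [|split].
  - rewrite RInt_point, Rmult_0_l. apply Rplus_0_l.
  - apply (continuous_plus (fun x => x * sqrt (L x)) (RInt q 0)).
    + exact continuous_x_sqrt_L.
    + apply (ex_derive_continuous (RInt q 0) 0). exists (q 0). apply HI.
      rewrite Rabs_R0. lra.
  - apply locally_Rabs_intro with 1; [lra|].
    intros x Hx H0. rewrite Rminus_0_r in Hx.
    pose proof (sqrt_lt_R0 _ (L_pos x H0 Hx)) as Hs.
    replace (sqrt (L x)) with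
      ((1 * sqrt (L x) + x * - / (2 * x * sqrt (L x))) + q x)
      by (unfold q; field; lra).
    apply (is_derive_plus (fun x => x * sqrt (L x)) (RInt q 0)); [|now apply HI].
    apply (is_derive_Rmult (fun y => y) (fun y => sqrt (L y))); [apply @is_derive_id|].
    now apply is_derive_sqrt_L.
Qed.

(** * First and second derivative tests at a local minimum *)

Lemma is_derive_local_min (w : R -> R) (x d : R) :
  is_derive w x d -> locally x (fun y => w x <= w y) -> d = 0.
Proof.
  intros Hd Hmin.
  destruct (locally_Rabs_elim _ _ Hmin) as [e [He Hle]].
  apply is_derive_Reals in Hd.
  change d with (derive_pt w x (exist _ d Hd)).
  apply (deriv_minimum w (x - e) (x + e) x); [lra | lra |].
  intros y Hy1 Hy2. apply Hle, Rabs_def1; lra.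
Qed.

(** If [l < 0], then [dw], which vanishes at [x], is negative just to the right of [x], and the mean
    value theorem makes [w] drop below [w x] there. *)
Lemma second_derivative_local_min (w dw : R -> R) (x l : R) :
  locally x (fun y => is_derive w y (dw y)) -> is_derive dw x l ->
  locally x (fun y => w x <= w y) -> dw x = 0 /\ 0 <= l.
Proof.
  intros Hw Hdw Hmin.
  assert (H0 : dw x = 0).
  { apply (is_derive_local_min w x); [|exact Hmin].
    exact (locally_singleton _ _ Hw). }
  split; [exact H0|].
  apply Rnot_lt_le; intros Hl.
  apply is_derive_Reals in Hdw.
  destruct (Hdw (- l)) as [e Hneg]; [lra|].
  destruct (locally_Rabs_elim _ _ Hw) as [e1 [He1 Hw1]].
  destruct (locally_Rabs_elim _ _ Hmin) as [e2 [He2 Hle]].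
  set (h := Rmin e (Rmin e1 e2) / 2).
  assert (Hh : 0 < h /\ h < e /\ h < e1 /\ h < e2).
  { pose proof (cond_pos e).
    pose proof (Rmin_l e (Rmin e1 e2)). pose proof (Rmin_r e (Rmin e1 e2)).
    pose proof (Rmin_l e1 e2). pose proof (Rmin_r e1 e2).
    assert (0 < Rmin e (Rmin e1 e2)) by (apply Rmin_pos; [|apply Rmin_pos]; lra).
    unfold h. lra. }
  destruct (MVT_cor2 w dw x (x + h)) as [c [Hc1 Hc2]]; [lra| |].
  { intros c Hc. apply is_derive_Reals, Hw1, Rabs_def1; lra. }
  assert (Hwh : w x <= w (x + h)) by (apply Hle, Rabs_def1; lra).
  assert (Hdc : dw c < 0).
  (* As [dw x = 0], the difference quotient is [dw c / (c - x)]; being within [- l] of [l], it is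
     negative. *)
  { specialize (Hneg (c - x)).
    replace (x + (c - x)) with c in Hneg by ring.
    rewrite H0, Rminus_0_r in Hneg.
    assert (Hq : Rabs (dw c / (c - x) - l) < - l)
      by (apply Hneg; [lra | apply Rabs_def1; lra]).
    apply Rabs_def2 in Hq.
    replace (dw c) with (dw c / (c - x) * (c - x)) by (field; lra). nra. }
  nra.
Qed.

(** * The vertical tangent at the origin *)

(** By the mean value theorem, [u x / x] is a value of [u'] near [0], hence large. Multiplying by
    [x ^ 2] treats both signs of [x] at once. *)
Lemma log_profile_steep (u : R -> R) (K : R) :
  log_profile u -> locally 0 (fun x => K * x ^ 2 <= x * u x).
Proof.
  intros [Hu0 [Hcont Hder]].
  destruct (locally_Rabs_elim _ _ Hder) as [d [Hd Hu]].
  apply locally_Rabs_intro with (Rmin d (exp (- K ^ 2))).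
  { apply Rmin_pos; [exact Hd | apply exp_pos]. }
  intros x Hx. rewrite Rminus_0_r in Hx.
  pose proof (Rlt_le_trans _ _ _ Hx (Rmin_l _ _)) as Hx1.
  pose proof (Rlt_le_trans _ _ _ Hx (Rmin_r _ _)) as Hx2.
  destruct (Req_dec x 0) as [->|Hx0]; [lra|].
  assert (Hbd : forall y, Rmin 0 x <= y <= Rmax 0 x -> Rabs y <= Rabs x).
  { intros y. unfold Rmin, Rmax, Rabs.
    destruct (Rle_dec 0 x), (Rcase_abs y), (Rcase_abs x); lra. }
  assert (Hin : forall y, Rmin 0 x < y < Rmax 0 x -> y <> 0).
  { intros y. unfold Rmin, Rmax. destruct (Rle_dec 0 x); lra. }
  (* [MVT_gen] only locates [c] in the closed interval, and [sqrt (L 0)] is [0] by convention. The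
     maximum with [K] agrees with [u'] in the open interval and keeps the lower bound at the
     endpoint. *)
  destruct (MVT_gen u 0 x (fun y => Rmax K (sqrt (L y)))) as [c [_ Hc]].
  - intros y Hy. pose proof (Hin y Hy) as Hy0.
    assert (Hyx : Rabs y <= Rabs x) by (apply Hbd; lra).
    rewrite Rmax_right.
    + apply Hu; [rewrite Rminus_0_r; lra | exact Hy0].
    + apply Rlt_le, sqrt_L_gt; [exact Hy0 | lra].
  - intros y Hy. apply continuity_pt_filterlim.
    destruct (Req_dec y 0) as [->|Hy0]; [exact Hcont|].
    apply (ex_derive_continuous u y). exists (sqrt (L y)).
    apply Hu; [|exact Hy0]. rewrite Rminus_0_r. specialize (Hbd y Hy). lra.
  - rewrite Hu0, !Rminus_0_r in Hc. rewrite Hc.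
    replace (x * (Rmax K (sqrt (L c)) * x)) with (Rmax K (sqrt (L c)) * x ^ 2) by ring.
    apply Rmult_le_compat_r; [apply pow2_ge_0 | apply Rmax_l].
Qed.

(** The difference quotient is eventually below [d + 1]; in this form the bound contradicts
    [log_profile_steep] taken with [K = d + 1]. *)
Lemma is_derive_slope_lt (f : R -> R) (x d : R) :
  is_derive f x d ->
  locally x (fun y => y <> x -> (y - x) * (f y - f x) < (d + 1) * (y - x) ^ 2).
Proof.
  intros Hd. apply is_derive_Reals in Hd.
  destruct (Hd 1 Rlt_0_1) as [e He].
  apply locally_Rabs_intro with e; [apply cond_pos|].
  intros y Hy Hyx.
  assert (Hne : y - x <> 0) by lra.
  specialize (He (y - x) Hne Hy).
  replace (x + (y - x)) with y in He by ring.
  apply Rabs_def2 in He.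
  replace ((y - x) * (f y - f x)) with ((f y - f x) / (y - x) * (y - x) ^ 2)
    by (field; exact Hne).
  apply Rmult_lt_compat_r; [|lra].
  pose proof (pow2_gt_0 _ Hne). lra.
Qed.

Lemma log_profile_not_lipschitz (u : R -> R) :
  log_profile u -> ~ lipschitz_at u 0.
Proof.
  intros Hu [K HK].
  pose proof (log_profile_steep u (K + 1) Hu) as Hs.
  destruct Hu as [Hu0 _].
  destruct (locally_Rabs_elim _ _ (filter_and _ _ HK Hs)) as [e [He H]].
  assert (Hx : Rabs (e / 2 - 0) < e) by (apply Rabs_def1; lra).
  destruct (H _ Hx) as [H1 H2].
  rewrite Hu0, !Rminus_0_r, (Rabs_pos_eq (e / 2)) in H1 by lra.
  pose proof (Rle_abs (u (e / 2))). nra.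
Qed.

Lemma log_profile_not_touched_above (u phi : R -> R) :
  log_profile u -> ex_derive phi 0 -> phi 0 = u 0 ->
  ~ locally 0 (fun x => u x <= phi x).
Proof.
  intros Hu [d Hd] H0 Hle.
  pose proof (log_profile_steep u (d + 1) Hu) as Hs.
  pose proof (is_derive_slope_lt _ _ _ Hd) as Hsl.
  destruct Hu as [Hu0 _]. rewrite Hu0 in H0.
  destruct (locally_Rabs_elim _ _ (filter_and _ _ Hle (filter_and _ _ Hs Hsl)))
    as [e [He H]].
  (* To the right of [0] the steeper graph of [u] lies above [phi]. *)
  assert (Hx : Rabs (e / 2 - 0) < e) by (apply Rabs_def1; lra).
  destruct (H _ Hx) as [H1 [H2 H3]].
  rewrite H0, !Rminus_0_r in H3. specialize (H3 ltac:(lra)). nra.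
Qed.

Lemma log_profile_not_touched_below (u phi : R -> R) :
  log_profile u -> ex_derive phi 0 -> phi 0 = u 0 ->
  ~ locally 0 (fun x => phi x <= u x).
Proof.
  intros Hu [d Hd] H0 Hle.
  pose proof (log_profile_steep u (d + 1) Hu) as Hs.
  pose proof (is_derive_slope_lt _ _ _ Hd) as Hsl.
  destruct Hu as [Hu0 _]. rewrite Hu0 in H0.
  destruct (locally_Rabs_elim _ _ (filter_and _ _ Hle (filter_and _ _ Hs Hsl)))
    as [e [He H]].
  (* To the left of [0] the steeper graph of [u] lies below [phi]. *)
  assert (Hx : Rabs (- (e / 2) - 0) < e) by (apply Rabs_def1; lra).
  destruct (H _ Hx) as [H1 [H2 H3]].
  rewrite H0, !Rminus_0_r in H3. specialize (H3 ltac:(lra)). nra.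
Qed.

(** * The viscosity property *)

(** At a contact point [phi - u] or [u - phi] has a local minimum with value [0], so the second
    derivative test applies to the difference. *)
Lemma viscosity_at_classical_point (u du phi : R -> R) (x l : R) :
  locally x (fun y => is_derive u y (du y)) -> is_derive du x l ->
  C2_near phi x -> phi x = u x ->
  (locally x (fun y => phi y >= u y) -> Derive phi x = du x /\ l <= Derive_n phi 2 x) /\
  (locally x (fun y => phi y <= u y) -> Derive phi x = du x /\ Derive_n phi 2 x <= l).
Proof.
  intros Hu Hdu HC Heq.
  assert (Hphi : locally x (fun y => is_derive phi y (Derive phi y))).
  { revert HC. unfold C2_near. apply filter_imp. intros y [Hy _]. now apply Derive_correct. }
  assert (Hdphi : is_derive (Derive phi) x (Derive_n phi 2 x)).
  { destruct (locally_singleton _ _ HC) as [_ [Hx _]].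
    exact (Derive_correct _ _ Hx). }
  split; intros Hloc.
  - destruct (second_derivative_local_min (fun y => phi y - u y)
      (fun y => Derive phi y - du y) x (Derive_n phi 2 x - l)) as [H1 H2].
    + generalize (filter_and _ _ Hphi Hu). apply filter_imp.
      intros y [Hy1 Hy2]. exact (is_derive_minus phi u y _ _ Hy1 Hy2).
    + exact (is_derive_minus (Derive phi) du x _ _ Hdphi Hdu).
    + revert Hloc. apply filter_imp. intros y Hy. lra.
    + lra.
  - destruct (second_derivative_local_min (fun y => u y - phi y)
      (fun y => du y - Derive phi y) x (l - Derive_n phi 2 x)) as [H1 H2].
    + generalize (filter_and _ _ Hphi Hu). apply filter_imp.
      intros y [Hy1 Hy2]. exact (is_derive_minus u phi y _ _ Hy2 Hy1).
    + exact (is_derive_minus du (Derive phi) x _ _ Hdu Hdphi).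
    + revert Hloc. apply filter_imp. intros y Hy. lra.
    + lra.
Qed.

Lemma exp_2_sqrt_L_sqr (x : R) :
  x <> 0 -> Rabs x < 1 -> exp (2 * sqrt (L x) ^ 2) = / x ^ 2.
Proof.
  intros Hx H1. rewrite pow2_sqrt by (apply Rlt_le, L_pos; assumption).
  unfold L. replace (2 * - ln (Rabs x)) with (- (ln (Rabs x) + ln (Rabs x))) by ring.
  assert (H0 : 0 < Rabs x) by now apply Rabs_pos_lt.
  rewrite exp_Ropp, exp_plus, exp_ln by exact H0.
  now rewrite <- (pow2_abs x), <- Rsqr_pow2.
Qed.

(** This is the equation itself off the origin: with [p = sqrt (L x)] one has [g p = / (x ^ 2 * p)],
    and the right-hand side is [atan] of [u'']. *)
Lemma phase_at_profile (g : R -> R) (M x : R) :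
  (forall p, M < Rabs p -> g p = exp (2 * p ^ 2) / p) ->
  x <> 0 -> Rabs x < 1 -> M < sqrt (L x) ->
  phase g x (sqrt (L x)) = atan (- / (2 * x * sqrt (L x))).
Proof.
  intros Hg Hx H1 HM. pose proof (sqrt_lt_R0 _ (L_pos x Hx H1)) as Hs.
  unfold phase. rewrite <- atan_opp, Hg by (rewrite Rabs_pos_eq; lra).
  rewrite exp_2_sqrt_L_sqr by assumption.
  f_equal. field. split; lra.
Qed.

Lemma log_profile_viscosity (u g : R -> R) (M d : R) :
  log_profile u ->
  (forall p, M < Rabs p -> g p = exp (2 * p ^ 2) / p) ->
  (forall x, x <> 0 -> Rabs x < d -> is_derive u x (sqrt (L x))) ->
  (forall x, x <> 0 -> Rabs x < d -> M < sqrt (L x)) -> d <= 1 ->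
  viscosity_solution (fun x _ p => phase g x p) (- d) d u.
Proof.
  intros Hu Hg Hder HM Hd. split.
  - intros x Hx. destruct (Req_dec x 0) as [->|Hx0]; [apply Hu|].
    apply (ex_derive_continuous u x). exists (sqrt (L x)).
    apply Hder; [exact Hx0 | apply Rabs_def1; lra].
  - intros x Hx phi HC Heq. destruct (Req_dec x 0) as [->|Hx0].
    + destruct (locally_singleton _ _ HC) as [Hex _].
      split; intros Hloc; exfalso.
      * apply (log_profile_not_touched_above u phi Hu Hex Heq).
        revert Hloc. apply filter_imp. intros y Hy. lra.
      * exact (log_profile_not_touched_below u phi Hu Hex Heq Hloc).
    + assert (Hxd : Rabs x < d) by (apply Rabs_def1; lra).
      assert (Hx1 : Rabs x < 1) by lra.
      pose proof (phase_at_profile g M x Hg Hx0 Hx1 (HM x Hx0 Hxd)) as Hph.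
      destruct (viscosity_at_classical_point u (fun y => sqrt (L y)) phi x
        (- / (2 * x * sqrt (L x)))) as [Habove Hbelow]; trivial.
      * now apply (locally_punctured x d).
      * now apply is_derive_sqrt_L.
      * split; intros Hloc.
        -- destruct (Habove Hloc) as [-> Hl]. rewrite Hph.
           destruct Hl as [Hl|Hl]; [left; now apply atan_increasing | right; now rewrite Hl].
        -- destruct (Hbelow Hloc) as [-> Hl]. rewrite Hph.
           destruct Hl as [Hl|Hl]; [left; now apply atan_increasing | right; now rewrite Hl].
Qed.

(** * Failure of the two structure conditions *)

Lemma L_exp_neg (t : R) : L (exp (- t)) = t.
Proof.
  unfold L. rewrite Rabs_pos_eq by (apply Rlt_le, exp_pos). rewrite ln_exp. ring.
Qed.

(* The abscissa is chosen so that [1/2 * x * g p = 1]. *)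
Lemma near_range_arctan_one (u : R -> R) (eta A : R) :
  0 < eta ->
  (forall x, x <> 0 -> Rabs x < eta -> is_derive u x (sqrt (L x))) ->
  exists p, A < p /\ 1 < p /\ near_range u eta (2 * p / exp (2 * p ^ 2)) p.
Proof.
  intros Heta Hder.
  assert (Hie : 0 < / eta) by now apply Rinv_0_lt_compat.
  (* Exceeding [/ eta] ensures [exp (- p ^ 2) < eta], because [p < exp (p ^ 2)]. *)
  set (p := Rmax 1 (Rmax A (/ eta)) + 1).
  pose proof (Rmax_l 1 (Rmax A (/ eta))). pose proof (Rmax_r 1 (Rmax A (/ eta))).
  pose proof (Rmax_l A (/ eta)). pose proof (Rmax_r A (/ eta)).
  assert (Hp : 1 < p /\ A < p /\ / eta < p) by (unfold p; lra).
  clearbody p. destruct Hp as [Hp1 [HpA Hpe]].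
  exists p. split; [exact HpA|]. split; [exact Hp1|].
  pose proof (exp_ineq1_le (p ^ 2)) as He.
  pose proof (exp_pos (p ^ 2)) as Hep.
  assert (Hy : exp (- p ^ 2) < eta).
  { rewrite exp_Ropp, <- (Rinv_inv eta).
    apply Rinv_lt_contravar; nra. }
  split.
  (* The abscissa is at most [exp (- p ^ 2)], since [2 * p <= 1 + p ^ 2 <= exp (p ^ 2)]. *)
  - apply Rle_lt_trans with (2 := Hy).
    replace (2 * p ^ 2) with (p ^ 2 + p ^ 2) by ring.
    rewrite exp_plus, exp_Ropp.
    replace (2 * p / (exp (p ^ 2) * exp (p ^ 2)))
      with (2 * p / exp (p ^ 2) * / exp (p ^ 2)) by (field; lra).
    assert (Hi : 0 < / exp (p ^ 2)) by now apply Rinv_0_lt_compat.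
    rewrite Rabs_pos_eq by (apply Rmult_le_pos; [apply Rdiv_le_0_compat|]; lra).
    rewrite <- (Rmult_1_l (/ exp (p ^ 2))) at 2.
    apply Rmult_le_compat_r; [lra|].
    apply Rmult_le_reg_r with (exp (p ^ 2)); [exact Hep|].
    unfold Rdiv. rewrite Rmult_assoc, Rinv_l by lra. nra.
  (* The slope [p] is attained at [exp (- p ^ 2)], a point distinct in role from the abscissa of the
     pair. *)
  - pose proof (exp_pos (- p ^ 2)) as Hy0.
    exists (exp (- p ^ 2)). rewrite Rabs_pos_eq by lra. split; [lra|].
    symmetry. apply is_derive_unique.
    replace p with (sqrt (L (exp (- p ^ 2)))) at 2
      by (rewrite L_exp_neg; apply sqrt_pow2; lra).
    apply Hder; [lra|]. rewrite Rabs_pos_eq; lra.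
Qed.

Lemma phase_fails_p_condition (u g : R -> R) (M eta : R) :
  (forall p, M < Rabs p -> g p = exp (2 * p ^ 2) / p) ->
  0 < eta ->
  (forall x, x <> 0 -> Rabs x < eta -> is_derive u x (sqrt (L x))) ->
  ~ p_condition (phase g) (near_range u eta).
Proof.
  intros Hg Heta Hder [C HC].
  destruct (near_range_arctan_one u eta (Rmax M (Rabs C)) Heta Hder)
    as [p [HpA [Hp1 Hnr]]].
  pose proof (Rmax_l M (Rabs C)). pose proof (Rmax_r M (Rabs C)).
  specialize (HC _ _ Hnr).
  pose proof (exp_pos (2 * p ^ 2)) as He.
  assert (Hv : phase g (2 * p / exp (2 * p ^ 2)) p = - (PI / 4)).
  { unfold phase. rewrite Hg by (rewrite Rabs_pos_eq; lra).
    rewrite <- atan_1. f_equal. f_equal. field. split; lra. }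
  assert (HD : Derive (fun q => phase g (2 * p / exp (2 * p ^ 2)) q) p
               = - ((4 * p ^ 2 - 1) / (2 * p))).
  { set (x := 2 * p / exp (2 * p ^ 2)).
    apply is_derive_unique.
    (* The derivative in [q] needs the formula for [g] on a whole neighbourhood of [p], which
       [q > Rmax M 0] provides. *)
    apply (is_derive_ext_loc (fun q => - atan (1 / 2 * x * (exp (2 * q ^ 2) / q)))).
    - apply locally_Rabs_intro with (p - Rmax M 0).
      + unfold Rmax. destruct (Rle_dec M 0); lra.
      + intros q Hq. apply Rabs_def2 in Hq.
        pose proof (Rmax_l M 0). pose proof (Rmax_r M 0).
        unfold phase. rewrite Hg; [reflexivity|].
        rewrite Rabs_pos_eq; lra.
    - auto_derive; [lra|].
      change (p * (p * 1)) with (p ^ 2).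
      replace (1 / 2 * x * (exp (2 * p ^ 2) * / p)) with 1
        by (unfold x; field; split; lra).
      unfold x. field. split; lra. }
  rewrite Hv, HD, Rabs_Ropp, (Rabs_pos_eq p) in HC by lra.
  rewrite Rabs_pos_eq in HC by (apply Rdiv_le_0_compat; nra).
  replace (p * ((4 * p ^ 2 - 1) / (2 * p))) with ((4 * p ^ 2 - 1) / 2) in HC
    by (field; lra).
  (* The bound would give [(4 * p ^ 2 - 1) / 2 <= Rabs C < p], impossible for [p > 1]. *)
  pose proof PI_4. pose proof PI_RGT_0. pose proof (Rle_abs C).
  pose proof (Rabs_pos C). nra.
Qed.

Lemma phase_fails_x_condition (u g : R -> R) (M eta : R) :
  (forall p, M < Rabs p -> g p = exp (2 * p ^ 2) / p) ->
  0 < eta ->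
  (forall x, x <> 0 -> Rabs x < eta -> is_derive u x (sqrt (L x))) ->
  ~ x_condition (phase g) (near_range u eta).
Proof.
  intros Hg Heta Hder [_ [C HC]].
  (* The factor [2] matches the lower bound [p / 2] for the derivative in [x], which the condition
     would bound by [Rabs C]. *)
  destruct (near_range_arctan_one u eta (Rmax M (2 * Rabs C)) Heta Hder)
    as [p [HpA [Hp1 Hnr]]].
  pose proof (Rmax_l M (2 * Rabs C)). pose proof (Rmax_r M (2 * Rabs C)).
  specialize (HC _ _ Hnr).
  pose proof (exp_pos (2 * p ^ 2)) as He.
  assert (Hgp : g p = exp (2 * p ^ 2) / p) by (apply Hg; rewrite Rabs_pos_eq; lra).
  assert (Hv : phase g (2 * p / exp (2 * p ^ 2)) p = - (PI / 4)).
  { unfold phase. rewrite Hgp, <- atan_1. f_equal. f_equal. field. split; lra. }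
  assert (HD : Derive (fun y => phase g y p) (2 * p / exp (2 * p ^ 2))
               = - (exp (2 * p ^ 2) / (4 * p))).
  { apply is_derive_unique. unfold phase. rewrite Hgp.
    auto_derive; [trivial|].
    change (p * (p * 1)) with (p ^ 2).
    replace (1 / 2 * (2 * p / exp (2 * p ^ 2)) * (exp (2 * p ^ 2) / p)) with 1
      by (field; split; lra).
    field. lra. }
  rewrite Hv, HD, Rabs_Ropp in HC.
  rewrite Rabs_pos_eq in HC by (apply Rdiv_le_0_compat; lra).
  assert (Hs : 0 <= sqrt (- (PI / 4) + PI / 2) <= 1).
  { split; [apply sqrt_pos|]. rewrite <- sqrt_1. apply sqrt_le_1_alt.
    pose proof PI_4. lra. }
  assert (Hge : p / 2 <= exp (2 * p ^ 2) / (4 * p)).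
  { apply Rmult_le_reg_r with (4 * p); [lra|].
    replace (exp (2 * p ^ 2) / (4 * p) * (4 * p)) with (exp (2 * p ^ 2)) by (field; lra).
    pose proof (exp_ineq1_le (2 * p ^ 2)). nra. }
  pose proof (Rle_abs C). pose proof (Rabs_pos C). nra.
Qed.

Theorem mainTheorem10 :
  (exists u : R -> R, log_profile u) /\
  (exists g : R -> R, admissible g) /\
  (forall u g : R -> R, log_profile u -> admissible g ->
     exists delta : R, 0 < delta /\
       viscosity_solution (fun x _ p => phase g x p) (- delta) delta u /\
       ~ lipschitz_at u 0 /\
       (forall eta : R, 0 < eta <= delta ->
          ~ p_condition (phase g) (near_range u eta) /\
          ~ x_condition (phase g) (near_range u eta))).
Proof.
  split; [exact log_profile_exists|]. split; [exact admissible_exists|].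
  intros u g Hu [_ [M Hg]].
  destruct (locally_Rabs_elim _ _ (proj2 (proj2 Hu))) as [d [Hd Hder]].
  (* The three bounds ensure, off the origin, that [L] is positive, that the formula for [u'] holds,
     and that [u'] exceeds [M], where [g] is explicit. *)
  set (delta := Rmin 1 (Rmin d (exp (- M ^ 2)))).
  assert (Hdelta : 0 < delta /\ delta <= 1 /\ delta <= d /\ delta <= exp (- M ^ 2)).
  { pose proof (Rmin_l 1 (Rmin d (exp (- M ^ 2)))).
    pose proof (Rmin_r 1 (Rmin d (exp (- M ^ 2)))).
    pose proof (Rmin_l d (exp (- M ^ 2))). pose proof (Rmin_r d (exp (- M ^ 2))).
    assert (0 < delta)
      by (repeat apply Rmin_pos; [lra | exact Hd | apply exp_pos]).
    unfold delta in *. lra. }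
  clearbody delta. destruct Hdelta as [Hpos [H1 [H2 H3]]].
  assert (Hder' : forall x, x <> 0 -> Rabs x < delta -> is_derive u x (sqrt (L x))).
  { intros x Hx Hxd. apply Hder; [rewrite Rminus_0_r; lra | exact Hx]. }
  exists delta. split; [exact Hpos|]. split; [|split].
  - apply (log_profile_viscosity u g M); trivial.
    intros x Hx Hxd. apply sqrt_L_gt; [exact Hx | lra].
  - now apply log_profile_not_lipschitz.
  - intros eta Heta.
    assert (Hder'' : forall x, x <> 0 -> Rabs x < eta -> is_derive u x (sqrt (L x)))
      by (intros x Hx Hxe; apply Hder'; [exact Hx | lra]).
    split; [apply (phase_fails_p_condition u g M) | apply (phase_fails_x_condition u g M)];
      trivial; lra.
Qed.
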